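(* Let $X$ be a finite-dimensional Euclidean or Hermitian space, $M\in\bigwedge X$, and $B\neq 0$ a blade in $\bigwedge X$. Then $B$ is an inner blade of $M$ (i.e. $[B]\subset\lfloor M\rfloor$) if, and only if, $M=B\wedge N$ for some $N\in\bigwedge X$. In this case, for each complement $V$ of $[B]$ in $X$ (i.e. each subspace $V$ with $X=[B]\oplus V$) there is a unique $N\in\bigwedge V$ such that $M=B\wedge N$.
   Context: $\bigwedge X$ is the exterior algebra of $X$. A blade is a scalar or an exterior product of vectors. For a nonzero blade $B=v_1\wedge\cdots\wedge v_p$, $[B]=\mathrm{span}\{v_1,\ldots,v_p\}$, and $[\lambda]=\{0\}$ for a scalar $\lambda$. The inner space of $M\in\bigwedge X$ is $\lfloor M\rfloor=\{v\in X:v\wedge M=0\}$ (so $\lfloor 0\rfloor=X$). An inner blade of $M$ is a blade $B\neq0$ with $[B]\subset\lfloor M\rfloor$. *)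

(* Defs.v *)
From HB Require Import structures.
From mathcomp Require Import all_boot all_order all_algebra all_field.
From mathcomp Require Import complex.
From mathcomp Require Import reals.

Set Implicit Arguments.
Unset Strict Implicit.
Unset Printing Implicit Defensive.

Import Order.TTheory GRing.Theory Num.Theory.
Local Open Scope ring_scope.

Variant scalar_kind := RealScalars | ComplexScalars.

Definition scalar_field (R : realType) (k : scalar_kind) : numFieldType :=
  match k with
  | RealScalars => R
  | ComplexScalars => R[i]
  end.

Definition scalar_conj (R : realType) (k : scalar_kind) :
    scalar_field R k -> scalar_field R k :=
  match k with
  | RealScalars => idfun
  | ComplexScalars => @conjc R
  end.

(* Let (e_i)_i be the basis vbasis {:X} of X. The products                    *)
(* e_I = e_i1 ^ ... ^ e_ik, for I = {i1 < ... < ik}, form a linear basis of   *)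
(* the exterior algebra, and an element is represented by its coordinates in  *)
(* this basis. Since e_I ^ e_J = 0 unless I and J are disjoint, in which case *)
(* it is e_(I :|: J) up to the sign of the permutation sorting I followed by  *)
(* J, the S-coordinate of a product only involves the partitions of S into    *)
(* two sets I and S :\: I.                                                    *)
(* The exterior product is the product of the ring exterior X, and a scalar c *)
(* is embedded as c%:A.                                                       *)
Definition exterior (K : fieldType) (X : vectType K) : Type :=
  {ffun {set 'I_(\dim {:X})} -> K^o}.

HB.instance Definition _ (K : fieldType) (X : vectType K) :=
  Vector.copy (exterior X) {ffun {set 'I_(\dim {:X})} -> K^o}.

Section Exterior.
Variables (K : fieldType) (X : vectType K).
Local Notation n := (\dim {:X}).
Local Notation e := (vbasis {:X}).
Local Notation E := (exterior X).
Implicit Types (I J S T : {set 'I_n}) (a b c : E) (v : X).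

Definition inversions I J : nat :=
  \sum_(i in I) \sum_(j in J) (j < i)%N.

Definition ext_basis I : E := [ffun S => (S == I)%:R].

Definition ext_mul a b : E :=
  [ffun S : {set 'I_n} => \sum_(I : {set 'I_n} | I \subset S)
    (-1) ^+ inversions I (S :\: I) * a I * b (S :\: I)].

Definition ext_one : E := ext_basis set0.

Definition ext_vec v : E := \sum_i coord e i v *: ext_basis [set i].

Lemma inversionsUl I J T : [disjoint I & J] ->
  inversions (I :|: J) T = (inversions I T + inversions J T)%N.
Proof.
move=> dIJ; rewrite /inversions -bigU //=.
by apply: eq_bigl => i; rewrite inE.
Qed.

Lemma inversionsUr I J T : [disjoint I & J] ->
  inversions T (I :|: J) = (inversions T I + inversions T J)%N.
Proof.
move=> dIJ; rewrite /inversions -big_split; apply: eq_bigr => i _ /=.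
rewrite -bigU //=; by apply: eq_bigl => j; rewrite inE.
Qed.

Lemma inversions0l J : inversions set0 J = 0%N.
Proof. by rewrite /inversions big_set0. Qed.

Lemma inversions0r I : inversions I set0 = 0%N.
Proof. by rewrite /inversions big1 // => i _; rewrite big_set0. Qed.

Lemma setU_setD I S : I \subset S -> I :|: (S :\: I) = S.
Proof. by move=> /setIidPr IS; rewrite -[in RHS](setID S I) IS. Qed.

Lemma disjoint_setD I S : [disjoint I & S :\: I].
Proof. by rewrite -setI_eq0 setIDA setIC -setIDA setDv setI0. Qed.

Lemma setUK_disjoint I J : [disjoint I & J] -> (I :|: J) :\: I = J.
Proof.
move=> dIJ; rewrite setDUl setDv set0U; apply/setDidPl.
by rewrite disjoint_sym.
Qed.

Lemma ext_mulA : associative ext_mul.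
Proof.
move=> a b c; apply/ffunP => S; rewrite !ffunE.
under [RHS]eq_bigr => T _ do rewrite ffunE mulr_sumr mulr_suml.
rewrite (exchange_big_dep (fun I => I \subset S)) /=; last first.
  by move=> T I TS IT; apply: subset_trans IT TS.
apply: eq_bigr => I IS; rewrite ffunE mulr_sumr.
rewrite [RHS](reindex_onto (fun J => I :|: J) (fun T => T :\: I)) /=; last first.
  by move=> T /andP[_ IT]; apply: setU_setD.
apply: eq_big => [J|J].
  rewrite subsetD subUset IS subsetUl /= andbT; congr (_ && _).
  rewrite disjoint_sym; apply/idP/eqP => [/setUK_disjoint //|<-].
  exact: disjoint_setD.
rewrite subsetD => /andP[JS dJI].
rewrite setUK_disjoint 1?disjoint_sym // -setDDl.
set L := (S :\: I) :\: J.
have dJL : [disjoint J & L] by apply: disjoint_setD.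
have -> : S :\: I = J :|: L by rewrite setU_setD // subsetD JS dJI.
rewrite inversionsUr // inversionsUl 1?disjoint_sym // !exprD.
set x := a I; set y := b J; set z := c L.
set p := (-1) ^+ _; set q := (-1) ^+ _; set r := (-1) ^+ _.
rewrite -!mulrA [LHS]mulrCA; congr (q * _).
by rewrite [RHS]mulrCA; congr (p * _); rewrite mulrCA.
Qed.

Lemma ext_mul1 : left_id ext_one ext_mul.
Proof.
move=> a; apply/ffunP => S; rewrite ffunE (bigD1 set0) ?sub0set //= big1.
  by rewrite addr0 ffunE eqxx setD0 inversions0l expr0 !mul1r.
by move=> I /andP[_ /negPf I0]; rewrite ffunE I0 mulr0 mul0r.
Qed.

Lemma ext_mulr1 : right_id ext_one ext_mul.
Proof.
move=> a; apply/ffunP => S; rewrite ffunE (bigD1 S) //= big1.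
  by rewrite addr0 ffunE setDv eqxx inversions0r expr0 mul1r mulr1.
move=> I /andP[IS nIS]; rewrite ffunE setD_eq0.
by move: nIS; rewrite eqEsubset IS /= => /negPf ->; rewrite mulr0.
Qed.

Lemma ext_mulDl : left_distributive ext_mul +%R.
Proof.
move=> a b c; apply/ffunP => S; rewrite !ffunE -big_split; apply: eq_bigr => I _.
by rewrite ffunE mulrDr mulrDl.
Qed.

Lemma ext_mulDr : right_distributive ext_mul +%R.
Proof.
move=> a b c; apply/ffunP => S; rewrite !ffunE -big_split; apply: eq_bigr => I _.
by rewrite ffunE mulrDr.
Qed.

Lemma ext_one_neq0 : ext_one != 0.
Proof. by apply/eqP => /ffunP/(_ set0)/eqP; rewrite !ffunE eqxx oner_eq0. Qed.

HB.instance Definition _ := GRing.Zmodule_isNzRing.Build E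
  ext_mulA ext_mul1 ext_mulr1 ext_mulDl ext_mulDr ext_one_neq0.

Lemma ext_scaleAl (x : K) a b : x *: (a * b) = (x *: a) * b.
Proof.
apply/ffunP => S; rewrite !ffunE scaler_sumr; apply: eq_bigr => I _.
by rewrite ffunE /GRing.scale /= !mulrA [x * _]mulrC.
Qed.

Lemma ext_scaleAr (x : K) a b : x *: (a * b) = a * (x *: b).
Proof.
apply/ffunP => S; rewrite !ffunE scaler_sumr; apply: eq_bigr => I _.
by rewrite ffunE /GRing.scale /= mulrCA.
Qed.

HB.instance Definition _ := GRing.Lmodule_isLalgebra.Build K E ext_scaleAl.
HB.instance Definition _ := GRing.Lalgebra_isAlgebra.Build K E ext_scaleAr.
HB.instance Definition _ := Algebra_isFalgebra.Build K E.

Lemma ext_vec_is_linear : linear ext_vec.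
Proof.
move=> x u v; rewrite /ext_vec scaler_sumr -big_split; apply: eq_bigr => i _ /=.
by rewrite linearP scalerA scalerDl.
Qed.

HB.instance Definition _ := GRing.isLinear.Build K X E _ ext_vec ext_vec_is_linear.

(* The following facts characterize (exterior X, ext_vec) up to isomorphism:  *)
(* vectors square to 0, and the products of distinct basis vectors, taken in  *)
(* increasing order, form a linear basis.                                     *)
Lemma ext_basisM I J : ext_basis I * ext_basis J =
  if [disjoint I & J] then (-1) ^+ inversions I J *: ext_basis (I :|: J) else 0.
Proof.
apply/ffunP => S; rewrite ffunE.
have [IS|nIS] := boolP (I \subset S); last first.
  rewrite big1 => [|T TS]; last first.
    rewrite ffunE; case: eqP => [TI|]; last by rewrite mulr0 mul0r.
    by rewrite -TI TS in nIS.
  case: ifP => _; rewrite !ffunE //; case: eqP => [SE|]; last by rewrite scaler0.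
  by rewrite SE subsetUl in nIS.
rewrite (bigD1 I) //= big1 => [|T /andP[_ /negPf TI]]; last first.
  by rewrite ffunE TI mulr0 mul0r.
rewrite addr0 !ffunE eqxx mulr1; case: eqP => [<-|neq].
  by rewrite disjoint_setD !ffunE setU_setD // eqxx.
case: ifP => dIJ; rewrite !ffunE ?mulr0 //.
case: eqP => [SE|]; last by rewrite scaler0.
by case: neq; rewrite SE setUK_disjoint.
Qed.

Lemma ext_vec_sqr v : ext_vec v * ext_vec v = 0.
Proof.
pose F (i j : 'I_n) : E :=
  (coord e i v *: ext_basis [set i]) * (coord e j v *: ext_basis [set j]).
have F0 i : F i i = 0.
  rewrite /F -scalerAl -scalerAr ext_basisM.
  by rewrite disjoints1 inE eqxx !scaler0.
have inv1 i j : inversions [set i] [set j] = (j < i)%N.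
  by rewrite /inversions !big_set1.
have FC (i j : 'I_n) : (i < j)%N -> F j i = - F i j.
  move=> ij; rewrite /F -!scalerAl -!scalerAr !scalerA [coord e j v * _]mulrC.
  rewrite -scalerN !ext_basisM !disjoints1 !inE !inv1 ij ltnNge (ltnW ij) /=.
  have /negPf -> : i != j by rewrite -val_eqE neq_ltn ij.
  have /negPf -> : j != i by rewrite -val_eqE neq_ltn ij orbT.
  by rewrite /= expr1 expr0 scaleN1r scale1r setUC.
rewrite /ext_vec mulr_suml; under eq_bigr => i _ do rewrite mulr_sumr.
rewrite pair_big /= (bigID (fun p : 'I_n * 'I_n => p.1 < p.2)%N) /=.
rewrite [X in _ + X](bigID (fun p : 'I_n * 'I_n => p.2 < p.1)%N) /=.
rewrite [X in _ + (_ + X)]big1 => [|[i j] /=]; last first.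
  by rewrite -!leqNgt -eqn_leq => /eqP/val_inj ->; exact: F0.
have swapI : injective (fun p : 'I_n * 'I_n => (p.2, p.1)).
  by move=> [? ?] [? ?] [-> ->].
rewrite addr0 [X in _ + X](reindex_inj swapI) /=.
rewrite [X in _ + X](eq_bigl (fun p : 'I_n * 'I_n => p.1 < p.2)%N); last first.
  by case=> i j /=; rewrite -leqNgt andb_idl // => /ltnW.
rewrite -big_split big1 // => -[i j] /= ij.
by rewrite -/(F i j) -/(F j i) (FC _ _ ij) subrr.
Qed.

Lemma ext_vec_vbasis (i : 'I_n) : ext_vec e`_i = ext_basis [set i].
Proof.
have fe := basis_free (vbasisP {:X}).
rewrite /ext_vec (bigD1 i) //= big1 => [|j /negPf ji].
  by rewrite addr0 coord_free // eqxx scale1r.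
by rewrite coord_free // eq_sym ji scale0r.
Qed.

Lemma ext_basisE I :
  ext_basis I = \prod_(i <- enum I) ext_vec e`_i.
Proof.
have sI : sorted (fun i j : 'I_n => i < j)%N (enum I).
  have: sorted ltn [seq val i | i <- enum I]; last by rewrite sorted_map.
  apply: (subseq_sorted ltn_trans _ (iota_ltn_sorted 0 n)).
  by rewrite -val_enum_ord map_subseq // enumT filter_subseq.
rewrite -[in LHS](set_enum I); elim: (enum I) sI => [_|i s IHs /= pis].
  by rewrite big_nil set_nil.
rewrite big_cons ext_vec_vbasis -IHs ?(path_sorted pis) // ext_basisM.
have /allP lti := order_path_min (fun _ _ _ => @ltn_trans _ _ _) pis.
rewrite disjoints1 inE; case: ifPn => [_|/negPn/lti]; last by rewrite ltnn.
rewrite /inversions big_set1 big1 ?scale1r ?set_cons // => j.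
by rewrite inE => /lti ij; rewrite ltnNge ltnW.
Qed.

Lemma ext_sumE a : a = \sum_I a I *: ext_basis I.
Proof.
apply/ffunP => S; rewrite sum_ffunE (bigD1 S) //= big1 => [|I /negPf SI].
  by rewrite addr0 !ffunE eqxx /GRing.scale /= mulr1.
by rewrite !ffunE eq_sym SI scaler0.
Qed.

(* The exterior algebra of a subspace V of X, as a subspace of exterior X:    *)
(* the subalgebra generated by V.                                             *)
Definition ext_sub (V : {vspace X}) : {vspace E} :=
  agenv (linfun ext_vec @: V)%VS.

(* blade_space B U states that B is a blade with [B] = U; it is a relation    *)
(* because [B] is defined from an expression of B. A zero product of vectors  *)
(* is covered by the scalar 0.                                                *)
Variant blade_space (B : E) : {vspace X} -> Prop :=
  | ScalarBlade (x : K) of B = x%:A : blade_space B 0%VS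
  | VectorBlade (s : seq X) of B != 0 & B = \prod_(v <- s) ext_vec v :
      blade_space B <<s>>%VS.

Definition inner_space (M : E) : {vspace X} :=
  lker (amulr M \o linfun ext_vec)%VF.

Lemma mem_inner_space M v : (v \in inner_space M) = (ext_vec v * M == 0).
Proof. by rewrite memv_ker comp_lfunE lfunE /= lfunE. Qed.

End Exterior.

(* Main.v *)
(* Contraction by a functional f is an antiderivation. If f(v) = 1 and f = 0  *)
(* on W, it kills the exterior algebra of W, so it recovers a from v ^ a for  *)
(* a in this algebra: left multiplication by v is injective there. Moreover   *)
(* any M over <v> + W is a + v ^ b with a, b over W, so that v ^ M = 0 forces *)
(* a = 0, i.e. M = v ^ b. Both facts pass to B = v_1 ^ ... ^ v_p by induction *)
(* on p, splitting off v_1 and taking W = <v_2, ..., v_p> + V.                *)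
Require Import Defs.
From HB Require Import structures.
From mathcomp Require Import all_boot all_order all_algebra all_field.
From mathcomp Require Import complex.
From mathcomp Require Import reals.

Import Order.TTheory GRing.Theory Num.Theory.
Local Open Scope ring_scope.

(** Each vector of $[B]$ annihilates $B$, hence $B\wedge N$ ([blade_vecM]): this is the easy
    direction. For the other, if $v\notin W$, the exterior algebra of $\langle v\rangle+W$ splits as
    $\bigwedge W\oplus v\wedge\bigwedge W$; left multiplication by $v$ kills the second summand and
    is injective on the first, so whatever $v$ kills is divisible by $v$, with a unique quotient
    over $W$ ([ext_vecM_factor], [ext_vecM_inj]). Injectivity rests on the antiderivation rule
    [contract_vecM]. The vectors of $B$ are then divided out one by one ([ext_prodM_factor],
    [ext_prodM_inj]), and [blade_factor] adds the scalar blades. *)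

Section ExteriorFactorization.
Set Implicit Arguments.
Unset Strict Implicit.

Variables (K : fieldType) (X : vectType K).
Local Notation n := (\dim {:X}).
Local Notation e := (vbasis {:X}).
Local Notation E := (exterior X).
Implicit Types (S : {set 'I_n}) (a b N M : E) (u v w : X).
Implicit Types (V W Y : {vspace X}) (s : seq X).

Lemma ext_vecC u v : ext_vec u * ext_vec v = - (ext_vec v * ext_vec u).
Proof.
have := ext_vec_sqr (u + v).
rewrite linearD mulrDl !mulrDr !ext_vec_sqr add0r addr0.
by move/eqP; rewrite addr_eq0 => /eqP.
Qed.

(** * Contraction by a functional *)

Lemma ext_basis1M (j : 'I_n) a S : (ext_basis [set j] * a) S =
  if j \in S then (-1) ^+ inversions [set j] (S :\ j) * a (S :\ j) else 0.
Proof.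
rewrite ffunE; case: ifPn => jS.
  rewrite (bigD1 [set j]) ?sub1set //= big1 => [|I /andP[_ /negPf Ij]].
    by rewrite addr0 ffunE eqxx mulr1.
  by rewrite ffunE Ij mulr0 mul0r.
rewrite big1 // => I IS; rewrite ffunE; case: eqP => [Ij|]; last first.
  by rewrite mulr0 mul0r.
by rewrite Ij sub1set (negPf jS) in IS.
Qed.

Lemma inversions11 (i j : 'I_n) : inversions [set i] [set j] = (j < i)%N.
Proof. by rewrite /inversions !big_set1. Qed.

(** Contraction by the dual basis vector $e_i^*$; the sign is the one in $e_i\wedge e_S=\pm
    e_{\{i\}\cup S}$. *)
Definition basis_contract (i : 'I_n) a : E :=
  [ffun S : {set 'I_n} => if i \in S then 0
             else (-1) ^+ inversions [set i] S * a (i |: S)].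

Lemma basis_contract_is_linear i : linear (basis_contract i).
Proof.
move=> x a b; apply/ffunP => S; rewrite !ffunE.
case: ifP => _; first by rewrite scaler0 addr0.
by rewrite mulrDr /GRing.scale /= mulrCA.
Qed.

HB.instance Definition _ i :=
  GRing.isLinear.Build K E E _ (basis_contract i) (basis_contract_is_linear i).

Lemma basis_contract_basisM (i j : 'I_n) a :
  basis_contract i (ext_basis [set j] * a) =
  (i == j)%:R *: a - ext_basis [set j] * basis_contract i a.
Proof.
apply/ffunP => S.
have -> : ((i == j)%:R *: a - ext_basis [set j] * basis_contract i a) S =
  (i == j)%:R * a S - (ext_basis [set j] * basis_contract i a) S by rewrite !ffunE.
rewrite [LHS]ffunE !ext_basis1M [basis_contract _ _ _]ffunE !inE.
have [<-|ij] := eqVneq i j.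
  rewrite mul1r /=; case: ifPn => iS.
    by rewrite setD1K // mulrA -expr2 sqrr_sign mul1r subrr.
  by rewrite setU1K // mulrA -expr2 sqrr_sign mul1r subr0.
rewrite mul0r sub0r /=.
case: (boolP (i \in S)) => iS; first by case: ifP => _; rewrite ?mulr0 oppr0.
case: ifPn => jS; last by rewrite mulr0 oppr0.
have -> : (i |: S) :\ j = i |: (S :\ j).
  by rewrite setDUl; congr (_ :|: _); apply/setDidPl; rewrite disjoints1 inE.
have -> : inversions [set i] S = ((j < i) + inversions [set i] (S :\ j))%N.
  by rewrite -{1}(setD1K jS) inversionsUr ?inversions11 // disjoints1 !inE eqxx.
rewrite inversionsUr ?disjoints1 ?inE ?(negPf iS) ?andbF // inversions11.
rewrite -mulNr !mulrA -exprD mulNr -exprD.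
congr (_ * _).
(* Exactly one of [i < j] and [j < i] holds, so the two signs differ by one transposition: this is
   the minus sign of the antiderivation rule. *)
have : ((i < j)%N : nat) = ~~ (j < i)%N.
  by rewrite -leqNgt ltn_neqAle (ij : i != j :> nat).
by case: (j < i)%N => /= ->;
  rewrite ?add0n ?addn0 ?add1n ?addnS !exprS ?mulN1r ?opprK addnC.
Qed.

Definition contract (f : {scalar X}) a : E :=
  \sum_(i < n) f e`_i *: basis_contract i a.

Lemma contract_is_linear (f : {scalar X}) : linear (contract f).
Proof.
move=> x a b; rewrite /contract scaler_sumr -big_split; apply: eq_bigr => i _ /=.
by rewrite linearP scalerDr !scalerA mulrC.
Qed.

HB.instance Definition _ (f : {scalar X}) :=
  GRing.isLinear.Build K E E _ (contract f) (contract_is_linear f).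

(** Both sides are linear in [u], which reduces the rule to basis vectors. *)
Lemma contract_vecM (f : {scalar X}) u a :
  contract f (ext_vec u * a) = f u *: a - ext_vec u * contract f a.
Proof.
have vbM (j : 'I_n) : contract f (ext_basis [set j] * a) =
    f e`_j *: a - ext_basis [set j] * contract f a.
  rewrite /contract mulr_sumr.
  under eq_bigr => i _ do rewrite basis_contract_basisM scalerBr.
  rewrite sumrB; congr (_ - _); last first.
    by apply: eq_bigr => i _; rewrite -scalerAr.
  rewrite (bigD1 j) //= big1 => [|i /negPf ij]; last first.
    by rewrite ij scale0r scaler0.
  by rewrite eqxx scale1r addr0.
rewrite [in f u](coord_vbasis (memvf u)) linear_sum /ext_vec !mulr_suml.
rewrite linear_sum scaler_suml -sumrB; apply: eq_bigr => j _.
by rewrite -!scalerAl !linearZ /= vbM scalerBr scalerA scalerN.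
Qed.

Lemma contract1 (f : {scalar X}) : contract f 1 = 0.
Proof.
rewrite /contract big1 // => i _; apply/eqP; rewrite scaler_eq0; apply/orP; right.
apply/eqP/ffunP => S; rewrite !ffunE; case: ifP => // _.
rewrite (_ : (i |: S == set0) = false) ?mulr0 //.
by apply/eqP => /setP/(_ i); rewrite !inE eqxx.
Qed.

(** * Exterior algebras of subspaces *)

Lemma ext_vec_sub V v : v \in V -> ext_vec v \in ext_sub V.
Proof.
move=> Vv; apply: (subvP (sub_agenv _)); apply/memv_imgP; exists v => //.
by rewrite lfunE.
Qed.

Lemma ext_sub1 V : 1 \in ext_sub V.
Proof. by apply: (subvP (sub1_agenv _)); apply: memv_line. Qed.

Lemma ext_subM V a b : a \in ext_sub V -> b \in ext_sub V -> a * b \in ext_sub V.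
Proof. by move=> Va Vb; rewrite /ext_sub -agenvM memv_mul. Qed.

Lemma ext_subS V W : (V <= W)%VS -> (ext_sub V <= ext_sub W)%VS.
Proof. by move=> VW; apply/agenvS/limgS. Qed.

(** Induction principle for [ext_sub V]: stability under left multiplication by vectors of [V]
    suffices, and [A] need not be a subalgebra. *)
Lemma ext_sub_min V (A : {vspace E}) : 1 \in A ->
  (forall v a, v \in V -> a \in A -> ext_vec v * a \in A) -> (ext_sub V <= A)%VS.
Proof.
move=> A1 VA; apply: agenv_sub_modl; first by rewrite -memvE.
apply/prodvP => _ a /memv_imgP[v Vv ->] Aa; rewrite lfunE; exact: VA.
Qed.

Lemma mem_ext_subf a : a \in ext_sub fullv.
Proof.
rewrite (ext_sumE a); apply: memv_suml => I _; apply: memvZ; rewrite ext_basisE.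
apply: (big_ind (fun b : E => b \in ext_sub fullv)) => [||i _].
- exact: ext_sub1.
- exact: ext_subM.
exact: ext_vec_sub (memvf _).
Qed.

Lemma contract_ext_sub (f : {scalar X}) W a : {in W, forall w, f w = 0} ->
  a \in ext_sub W -> contract f a = 0.
Proof.
move=> Wf; suff /subvP kerW : (ext_sub W <= lker (linfun (contract f)))%VS.
  by move/kerW; rewrite memv_ker lfunE => /eqP.
apply: ext_sub_min => [|w b Ww]; rewrite !memv_ker !lfunE /= ?contract1 //.
move/eqP=> b0.
by rewrite contract_vecM Wf // b0 mulr0 scale0r subr0.
Qed.

(** * Dividing by one vector *)

Lemma separating_functional v W : v \notin W ->
  exists f : {scalar X}, f v = 1 /\ {in W, forall w, f w = 0}.
Proof.
move=> nWv; have v0 : v != 0 by apply: contraNneq nWv => ->; apply: mem0v.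
have vW : (<[v]> :&: W = 0)%VS.
  apply/eqP; rewrite -subv0; apply/subvP => x; rewrite memv_cap.
  case/andP=> /vlineP[c ->] Wcv; rewrite memv0 scaler_eq0.
  have [//|c0] := eqVneq c 0; case/negP: nWv.
  by rewrite -[v](scalerK c0) memvZ.
have fv : free [tuple v] by rewrite seq1_free.
(* Project onto the line of [v] along [W], then read the coefficient of [v]. *)
exists (coord [tuple v] ord0 \o daddv_pi <[v]> W); split=> [|w Ww] /=.
  rewrite daddv_pi_id ?memv_line //.
  by rewrite -[v in LHS]/([tuple v]`_(ord0 : 'I_1)) coord_free.
have := daddv_pi_add vW (subvP (addvSr _ _) _ Ww).
rewrite (daddv_pi_id (U := W)) ?(capvC W) //.
by move/eqP; rewrite -subr_eq0 addrK => /eqP ->; rewrite linear0.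
Qed.

Lemma ext_vecM_inj v W a : v \notin W -> a \in ext_sub W ->
  ext_vec v * a = 0 -> a = 0.
Proof.
move=> /separating_functional[f [fv Wf]] Wa va0.
have := contract_vecM f v a.
by rewrite va0 linear0 fv scale1r (contract_ext_sub Wf Wa) mulr0 subr0.
Qed.

Lemma ext_sub_addv_line v W M : M \in ext_sub (<[v]> + W) ->
  exists a b, [/\ a \in ext_sub W, b \in ext_sub W & M = a + ext_vec v * b].
Proof.
suff /subvP sub : (ext_sub (<[v]> + W) <=
    ext_sub W + amull (ext_vec v) @: ext_sub W)%VS.
  move/sub/memv_addP => [a Wa [_ /memv_imgP[b Wb ->] ->]].
  by exists a, b; split; rewrite // lfunE.
apply: ext_sub_min => [|u M' vWu]; first by rewrite (subvP (addvSl _ _)) ?ext_sub1.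
case/memv_addP => a Wa [_ /memv_imgP[b Wb ->] ->]; rewrite lfunE /=.
case/memv_addP: vWu => _ /vlineP[c ->] [w Ww ->].
(* Since $v\wedge v=0$ and $w\wedge v=-v\wedge w$, $(cv+w)\wedge(a+v\wedge b)=w\wedge
   a+v\wedge(ca-w\wedge b)$. *)
apply/memv_addP; exists (ext_vec w * a); first by rewrite ext_subM ?ext_vec_sub.
exists (ext_vec v * (c *: a - ext_vec w * b)).
  apply/memv_imgP; exists (c *: a - ext_vec w * b); last by rewrite lfunE.
  by rewrite memvB ?memvZ ?ext_subM ?ext_vec_sub.
rewrite linearD linearZ /= !(mulrDl, mulrDr) -!scalerAl -scalerAr !mulrA.
rewrite ext_vec_sqr mul0r scaler0 addr0 (ext_vecC w v) mulNr mulrN !mulrA.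
by rewrite !addrA; congr (_ - _); rewrite addrC.
Qed.

Lemma ext_vecM_factor v W M : v \notin W -> M \in ext_sub (<[v]> + W) ->
  ext_vec v * M = 0 -> exists2 N, N \in ext_sub W & M = ext_vec v * N.
Proof.
move=> nWv /ext_sub_addv_line[a [b [Wa Wb ->]]].
rewrite mulrDr mulrA ext_vec_sqr mul0r addr0 => /(ext_vecM_inj nWv Wa) ->.
by exists b; rewrite ?add0r.
Qed.

(** * Dividing by a product of vectors *)

Local Notation ext_prod s := (\prod_(v <- s) ext_vec v : E).

Lemma ext_vec_prod_span s u : u \in <<s>>%VS -> ext_vec u * ext_prod s = 0.
Proof.
suff /subvP sub : (<<s>> <= inner_space (ext_prod s))%VS.
  by move/sub; rewrite mem_inner_space => /eqP.
apply/span_subvP; elim: s => // v s IHs w; rewrite inE big_cons mem_inner_space.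
case/predU1P=> [->|/IHs]; first by rewrite mulrA ext_vec_sqr mul0r.
rewrite mem_inner_space => /eqP ws.
by rewrite mulrA ext_vecC mulNr -mulrA ws mulr0 oppr0.
Qed.

Lemma ext_prod_sub s V : (<<s>> <= V)%VS -> ext_prod s \in ext_sub V.
Proof.
move/span_subvP => sV; rewrite big_seq.
apply: (big_ind (fun b : E => b \in ext_sub V)) => [||v sv].
- exact: ext_sub1.
- exact: ext_subM.
exact: ext_vec_sub (sV v sv).
Qed.

(** Lets the inductions on [s] apply the one-vector lemmas with $W=\langle s\rangle+V$. If $v=a+b$
    with $a\in\langle s\rangle$ and $b\in V$, then $b=v-a$ lies in both spaces of the trivial
    intersection, so $v=a$ and the product vanishes. *)
Lemma ext_prod_cons_neq0 v s V : ext_prod (v :: s) != 0 ->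
  (<<v :: s>> :&: V = 0)%VS ->
  [/\ ext_prod s != 0, (<<s>> :&: V = 0)%VS & v \notin (<<s>> + V)%VS].
Proof.
rewrite big_cons span_cons => vs0 vsV; split.
- by apply: contraNneq vs0 => ->; rewrite mulr0.
- by apply/eqP; rewrite -subv0 -vsV capvS ?addvSr.
apply/negP => /memv_addP[a sa [b Vb vE]].
have : b \in (0 : {vspace X})%VS.
  rewrite -vsV memv_cap Vb andbT (_ : b = v - a); last by rewrite vE addrC addKr.
  by rewrite memv_add ?memv_line ?memvN.
rewrite memv0 => /eqP b0; case/eqP: vs0; apply: ext_vec_prod_span.
by rewrite vE b0 addr0.
Qed.

Lemma ext_prodM_inj s V N : ext_prod s != 0 -> (<<s>> :&: V = 0)%VS ->
  N \in ext_sub V -> ext_prod s * N = 0 -> N = 0.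
Proof.
move=> + + VN; elim: s => [|v s IHs]; first by rewrite big_nil mul1r.
move=> vs0 /(ext_prod_cons_neq0 vs0)[s0 sV nv].
rewrite big_cons -mulrA => /(ext_vecM_inj nv) sN0; apply: IHs => //; apply: sN0.
by rewrite ext_subM ?ext_prod_sub ?addvSl ?(subvP (ext_subS (addvSr _ _))).
Qed.

(** [M] ranges over the exterior algebra of $\langle s\rangle+V$ rather than of $X$ because each
    division by a vector leaves a quotient over a smaller space. *)
Lemma ext_prodM_factor s V M : ext_prod s != 0 -> (<<s>> :&: V = 0)%VS ->
  M \in ext_sub (<<s>> + V) -> (<<s>> <= inner_space M)%VS ->
  exists2 N, N \in ext_sub V & M = ext_prod s * N.
Proof.
elim: s M => [|v s IHs] M.
  by rewrite span_nil add0v => _ _ VM _; exists M; rewrite ?big_nil ?mul1r.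
move=> vs0 /(ext_prod_cons_neq0 vs0)[s0 sV nv].
rewrite span_cons -addvA subv_add -memvE mem_inner_space => sVM /andP[/eqP vM sM].
have [N sVN ME] := ext_vecM_factor nv sVM vM.
have [|N' VN' NE] := IHs N s0 sV sVN; last first.
  by exists N'; rewrite // big_cons -mulrA -NE.
(* The quotient [N] inherits the annihilation: $0=w\wedge M=-v\wedge(w\wedge N)$, and [v] can be
   cancelled as $w\wedge N$ is over $\langle s\rangle+V$. *)
apply/subvP => w sw; rewrite mem_inner_space; apply/eqP.
apply: (ext_vecM_inj nv).
  by rewrite ext_subM // ext_vec_sub // (subvP (addvSl _ _)).
have := subvP sM w sw; rewrite mem_inner_space ME mulrA ext_vecC mulNr oppr_eq0.
by rewrite -mulrA => /eqP.
Qed.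

(** * Blades *)

Lemma blade_vecM B U u : blade_space B U -> u \in U -> ext_vec u * B = 0.
Proof.
case=> [x ->|s _ ->]; last exact: ext_vec_prod_span.
by rewrite memv0 => /eqP ->; rewrite linear0 mul0r.
Qed.

Lemma blade_factor B U V M : B != 0 -> blade_space B U ->
  (U + V = fullv)%VS -> (U :&: V = 0)%VS -> (U <= inner_space M)%VS ->
  exists! N, N \in ext_sub V /\ M = B * N.
Proof.
move=> B0 BU UV U0V UM.
(* Uniqueness follows from injectivity applied to the difference of two factors. *)
suff [[N VN MN] inj] : (exists2 N, N \in ext_sub V & M = B * N) /\
    (forall N, N \in ext_sub V -> B * N = 0 -> N = 0).
  exists N; split=> // N' [VN' MN']; apply/eqP; rewrite -subr_eq0; apply/eqP.
  by apply: inj; rewrite ?memvB // mulrBr -MN -MN' subrr.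
case: BU B0 UV U0V UM => [x ->|s _ ->] B0 UV U0V UM.
  (* For a nonzero scalar blade [U] is zero, so [V] is all of [X] and the factor is $x^{-1}M$. *)
  have x0 : x != 0 by apply: contraNneq B0 => ->; rewrite scale0r.
  rewrite add0v in UV; split=> [|N _]; last first.
    by rewrite mulr_algl => /eqP; rewrite scaler_eq0 (negPf x0) => /eqP.
  exists (x^-1 *: M); first by rewrite UV mem_ext_subf.
  by rewrite mulr_algl scalerA divff // scale1r.
split=> [|N]; last exact: ext_prodM_inj.
by apply: ext_prodM_factor; rewrite // UV mem_ext_subf.
Qed.

End ExteriorFactorization.

Theorem theorem3p11 (R : realType) (k : scalar_kind)
    (X : vectType (scalar_field R k)) (ip : {dot X for @scalar_conj R k})
    (M B : exterior X) (U : {vspace X}) :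
  B != 0 -> blade_space B U ->
  ((U <= inner_space M)%VS <-> exists N : exterior X, M = B * N) /\
  ((U <= inner_space M)%VS ->
   forall V : {vspace X}, (U + V)%VS = fullv -> (U :&: V)%VS = 0%VS ->
   exists! N : exterior X, N \in ext_sub V /\ M = B * N).
Proof.
move=> B0 BU; split=> [|UM V UV U0V]; last exact: blade_factor B0 BU UV U0V UM.
split=> [UM|[N ->]].
  (* Any complement yields a factor; the chosen one is [U^C]. *)
  have [N [[_ MN] _]] := blade_factor B0 BU (addv_complf U) (capv_compl U) UM.
  by exists N.
apply/subvP => u Uu; rewrite mem_inner_space mulrA (blade_vecM BU Uu) mul0r.
exact: eqxx.
Qed.
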